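(* Let $R$ be a commutative ring with $1 \neq 0$, let $\Lambda \subseteq \operatorname{Spec} R$ be a set of prime ideals, and let $W := R \setminus \bigcup_{\mathfrak{p} \in \Lambda} \mathfrak{p}$. Then the following are equivalent: (1) $\Lambda$ satisfies prime avoidance. (2) $\operatorname{mSpec}(W^{-1}R) \subseteq \Lambda_{max}$. (3) $\operatorname{mSpec}(W^{-1}R) = \Lambda_{max}$. (4) $\operatorname{mSpec}(W^{-1}R) \subseteq \Lambda_{cl}$. (5) $\operatorname{Spec}(W^{-1}R) = \Lambda_{cl}$. (6) There is a ring map $\varphi : R \to S$ such that (i) $\Lambda_{max} = \varphi^*(\operatorname{mSpec} S)$ (so that there is an induced ring map $W^{-1}R \to S$), and (ii) the induced map $\operatorname{Spec} S \to \operatorname{Spec}(W^{-1}R)$ is surjective on closed points. (7) $\Lambda_{cl}$ satisfies prime avoidance. (8) $\Lambda_{max}$ satisfies prime avoidance and $\Lambda \subseteq (\Lambda_{max})_{cl}$.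
   Context: All rings are commutative with identity. $\operatorname{Spec} R$ is the set of prime ideals of $R$ and $\operatorname{mSpec} R$ is the set of maximal ideals of $R$. Prime avoidance: a set $\Lambda \subseteq \operatorname{Spec} R$ satisfies prime avoidance if for every ideal $I$ of $R$, $I \subseteq \bigcup_{\mathfrak{p} \in \Lambda} \mathfrak{p}$ implies $I \subseteq \mathfrak{p}$ for some $\mathfrak{p} \in \Lambda$. For $\Lambda \subseteq \operatorname{Spec} R$: - $\Lambda_{max} := \{\mathfrak{p} \in \Lambda \mid \mathfrak{p} \not\subseteq \mathfrak{q} \text{ for all } \mathfrak{q} \in \Lambda \text{ with } \mathfrak{q} \neq \mathfrak{p}\}$ is the subset of maximal elements of $\Lambda$ under inclusion (possibly empty even if $\Lambda$ is not). - $\Lambda_{cl} := \{\mathfrak{q} \in \operatorname{Spec} R \mid \exists\, \mathfrak{p} \in \Lambda,\ \mathfrak{q} \subseteq \mathfrak{p}\}$ is the downward-closure of $\Lambda$ in the poset $\operatorname{Spec} R$. The set $W$ is multiplicative. $\operatorname{Spec}(W^{-1}R)$ is viewed inside $\operatorname{Spec} R$ as $\{\mathfrak{p} \in \operatorname{Spec} R \mid \mathfrak{p} \cap W = \emptyset\}$ via contraction, and $\operatorname{mSpec}(W^{-1}R)$ is correspondingly viewed as a subset of $\operatorname{Spec} R$. For a ring map $\varphi : R \to S$, $\varphi^* : \operatorname{Spec} S \to \operatorname{Spec} R$ denotes contraction $\mathfrak{q} \mapsto \varphi^{-1}(\mathfrak{q})$. For a ring map $\psi : A \to S$, the map $\psi^*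 : \operatorname{Spec} S \to \operatorname{Spec} A$ is surjective on closed points if $\operatorname{mSpec} A \subseteq \psi^*(\operatorname{Spec} S)$ (equivalently, $\operatorname{mSpec} A \subseteq \psi^*(\operatorname{mSpec} S)$). The set $\Lambda$ may be empty, in which case $W = R$ and $W^{-1}R$ is the zero ring; the zero ring is allowed as a localization and as the target $S$ in (6). *)

(* Defs.v *)
From HB Require Import structures.
From mathcomp Require Import all_boot all_algebra.
From mathcomp Require Import boolp classical_sets.

Set Implicit Arguments.
Unset Strict Implicit.
Unset Printing Implicit Defensive.

Import GRing.Theory.

Local Open Scope classical_set_scope.
Local Open Scope ring_scope.
Local Open Scope quotient_scope.

(* MathComp's [idealr] is restricted to proper, decidable ideals of nontrivial
   rings; here the unit ideal and the zero ring are needed as well. *)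
Section Ideals.
Variable R : comPzRingType.
Implicit Types (I J p q : set R) (L : set (set R)).

Definition ideal I : Prop :=
  [/\ I 0, forall x y, I x -> I y -> I (x + y) & forall a x, I x -> I (a * x)].

Definition prime_ideal p : Prop :=
  [/\ ideal p, p <> setT & forall x y, p (x * y) -> p x \/ p y].

Definition maximal_ideal m : Prop :=
  [/\ ideal m, m <> setT &
      forall J, ideal J -> m `<=` J -> J = m \/ J = setT].

Definition Spec : set (set R) := [set p | prime_ideal p].

Definition mSpec : set (set R) := [set m | maximal_ideal m].

Definition prime_avoidance L : Prop :=
  forall I, ideal I -> I `<=` \bigcup_(p in L) p ->
    exists2 p, L p & I `<=` p.

Definition max_elts L : set (set R) :=
  [set p | L p /\ forall q, L q -> q <> p -> ~ p `<=` q].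

Definition down_closure L : set (set R) :=
  [set q | Spec q /\ exists2 p, L p & q `<=` p].

End Ideals.
Arguments Spec R : clear implicits.
Arguments mSpec R : clear implicits.

Definition spec_map (R S : comPzRingType) (phi : {rmorphism R -> S})
  (q : set S) : set R := phi @^-1` q.

Definition surjective_on_closed_points (A S : comPzRingType)
    (psi : {rmorphism A -> S}) : Prop :=
  mSpec A `<=` spec_map psi @` Spec S.

(* [0] may belong to a [mulset]; its localization is then the zero ring. *)
Record mulset (R : comPzRingType) := Mulset {
  mulset_set :> set R;
  mulset1 : mulset_set 1;
  mulsetM : forall x y, mulset_set x -> mulset_set y -> mulset_set (x * y) }.

Section PrimesComplement.
Variables (R : comPzRingType) (L : set (set R)).
Hypothesis LSpec : L `<=` Spec R.

Let W : set R := ~` \bigcup_(p in L) p.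

Fact primes_compl1 : W 1.
Proof.
case=> p /LSpec[[_ _ pM] pT _] p1; apply: pT.
by apply/seteqP; split=> // x _; rewrite -[x]mulr1; apply: pM.
Qed.

Fact primes_complM x y : W x -> W y -> W (x * y).
Proof.
move=> Wx Wy [p Lp pxy]; have [_ _ /(_ _ _ pxy)[px|py]] := LSpec Lp.
  by apply: Wx; exists p.
by apply: Wy; exists p.
Qed.

Definition primes_compl : mulset R := Mulset primes_compl1 primes_complM.

End PrimesComplement.

Module Localization.
Section Localization.
Variables (R : comPzRingType) (M : mulset R).
Local Notation W := (mulset_set M).

(* A pair (a, s) stands for the fraction a / s. *)
Definition frac := (R * set_type W)%type.
HB.instance Definition _ := Choice.on frac.

Implicit Types (x y z : frac).

Local Notation num x := (x.1 : R).
Local Notation den x := (val x.2 : R).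

Lemma denP x : W (den x).
Proof. by have := valP x.2; rewrite inE. Qed.

Definition mk (a s : R) (Ws : W s) : frac := (a, exist _ s (mem_set Ws)).

Definition eqv x y : bool :=
  `[< exists2 u, W u & u * (num x * den y) = u * (num y * den x) >].

Lemma eqv_refl : reflexive eqv.
Proof. by move=> x; apply/asboolP; exists 1 => //; exact: mulset1. Qed.

Lemma eqv_sym : symmetric eqv.
Proof.
by move=> x y; apply/asboolP/asboolP => -[u Wu e]; exists u; rewrite ?e.
Qed.

Lemma eqv_trans : transitive eqv.
Proof.
move=> y x z /asboolP[u Wu exy] /asboolP[v Wv eyz]; apply/asboolP.
exists (u * v * den y); first by do 2?apply: mulsetM => //; exact: denP.
have -> : u * v * den y * (num x * den z)
        = v * den z * (u * (num x * den y)).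
  by rewrite (AC (3*2) (2*5*(1*(4*3))))/=.
rewrite exy.
have -> : v * den z * (u * (num y * den x))
        = u * den x * (v * (num y * den z)).
  by rewrite (AC (2*(1*2)) (3*5*(1*(4*2))))/=.
by rewrite eyz (AC (2*(1*2)) (1*3*5*(4*2)))/=.
Qed.

Canonical eqv_equiv := EquivRel eqv eqv_refl eqv_sym eqv_trans.

Definition type := {eq_quot eqv}.
HB.instance Definition _ : EqQuotient _ eqv type := EqQuotient.on type.
HB.instance Definition _ := Choice.on type.

Lemma piP x y :
  reflect (exists2 u, W u & u * (num x * den y) = u * (num y * den x))
          (\pi_type x == \pi_type y).
Proof. by rewrite eqmodE; apply: asboolP. Qed.

Lemma reprP x : exists2 u, W u &
  u * (num x * den (repr (\pi_type x))) = u * (num (repr (\pi_type x)) * den x).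
Proof. by apply/piP; rewrite reprK. Qed.

Lemma pi_eq x y : num x * den y = num y * den x -> \pi_type x = \pi_type y.
Proof.
by move=> e; apply/eqP/piP; exists 1; [exact: mulset1 | rewrite e].
Qed.

Definition addf x y : frac :=
  mk (num x * den y + num y * den x) (mulsetM (denP x) (denP y)).
Definition add := lift_op2 type addf.

Lemma pi_add : {morph \pi : x y / addf x y >-> add x y}.
Proof.
move=> x y; unlock add; apply/eqP/piP => /=.
have [u Wu ex] := reprP x; have [v Wv ey] := reprP y.
move: (repr (\pi_type x)) (repr (\pi_type y)) ex ey => x' y' ex ey.
exists (u * v); first exact: mulsetM.
rewrite !mulrDl !mulrDr; congr (_ + _).
  transitivity (v * den y * den y' * (u * (num x * den x'))).
    by rewrite (AC (2*(2*2)) (2*4*6*(1*(3*5))))/=.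
  by rewrite ex (AC (3*(1*2)) (4*1*((5*3)*(6*2))))/=.
transitivity (u * den x * den x' * (v * (num y * den y'))).
  by rewrite (AC (2*(2*2)) (1*4*5*(2*(3*6))))/=.
by rewrite ey (AC (3*(1*2)) (1*4*((5*3)*(2*6))))/=.
Qed.
Canonical pi_add_morph := PiMorph2 pi_add.

Definition oppf x : frac := (- num x, x.2).
Definition opp := lift_op1 type oppf.

Lemma pi_opp : {morph \pi : x / oppf x >-> opp x}.
Proof.
move=> x; unlock opp; apply/eqP/piP => /=.
by have [u Wu ex] := reprP x; exists u => //; rewrite !mulNr !mulrN ex.
Qed.
Canonical pi_opp_morph := PiMorph1 pi_opp.

Definition mulf x y : frac := mk (num x * num y) (mulsetM (denP x) (denP y)).
Definition mul := lift_op2 type mulf.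

Lemma pi_mul : {morph \pi : x y / mulf x y >-> mul x y}.
Proof.
move=> x y; unlock mul; apply/eqP/piP => /=.
have [u Wu ex] := reprP x; have [v Wv ey] := reprP y.
exists (u * v); first exact: mulsetM.
move: (repr (\pi_type x)) (repr (\pi_type y)) ex ey => x' y' ex ey.
rewrite (AC (2*(2*2)) ((1*(3*5))*(2*(4*6))))/= ex ey.
by rewrite (AC ((1*2)*(1*2)) ((1*4)*((2*5)*(3*6))))/=.
Qed.
Canonical pi_mul_morph := PiMorph2 pi_mul.

Definition ofring := lift_embed type (fun a : R => mk a (mulset1 M)).
Canonical ofring_pi_morph := PiEmbed ofring.

Lemma addA : associative add.
Proof.
elim/quotW=> x; elim/quotW=> y; elim/quotW=> z; rewrite !piE.
apply: pi_eq => /=; congr (_ * _); last by rewrite mulrA.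
by rewrite !mulrDl !mulrA !addrA ![_ * _ * den x]mulrAC.
Qed.

Lemma addC : commutative add.
Proof.
elim/quotW=> x; elim/quotW=> y; rewrite !piE.
by apply: pi_eq; rewrite /= addrC [den y * _]mulrC.
Qed.

Lemma add0_l : left_id (ofring 0) add.
Proof.
by elim/quotW=> x; rewrite !piE; apply: pi_eq; rewrite /= mul0r add0r mulr1 mul1r.
Qed.

Lemma addN_l : left_inverse (ofring 0) opp add.
Proof.
by elim/quotW=> x; rewrite !piE; apply: pi_eq; rewrite /= mulNr addNr !mul0r.
Qed.

HB.instance Definition _ := GRing.isZmodule.Build type addA addC add0_l addN_l.

Lemma mulA : associative mul.
Proof.
elim/quotW=> x; elim/quotW=> y; elim/quotW=> z; rewrite !piE.
by apply: pi_eq; rewrite /= !mulrA.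
Qed.

Lemma mulC : commutative mul.
Proof.
elim/quotW=> x; elim/quotW=> y; rewrite !piE.
by apply: pi_eq; rewrite /= [num y * _]mulrC [den y * _]mulrC.
Qed.

Lemma mul1_l : left_id (ofring 1) mul.
Proof.
by elim/quotW=> x; rewrite !piE; apply: pi_eq; rewrite /= !mul1r.
Qed.

Lemma mul_addl : left_distributive mul add.
Proof.
elim/quotW=> x; elim/quotW=> y; elim/quotW=> z; rewrite !piE.
apply: pi_eq; rewrite /= !mulrDl; congr (_ + _);
  by rewrite (AC (3*(2*2)) ((1*3*(2*5))*(4*6*7)))/=.
Qed.

HB.instance Definition _ :=
  GRing.Zmodule_isComPzRing.Build type mulA mulC mul1_l mul_addl.

End Localization.
End Localization.
HB.export Localization.

Notation loc := Localization.type.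

Section LocalizationTheory.
Variables (R : comPzRingType) (M : mulset R).
Local Notation W := (mulset_set M).

Definition loc_map : R -> loc M := @Localization.ofring R M.

Fact loc_map_is_zmod_morphism : zmod_morphism loc_map.
Proof.
move=> x y; rewrite /loc_map; unlock Localization.ofring.
rewrite -[X in _ = _ + X]Localization.pi_opp -[RHS]Localization.pi_add.
by apply: Localization.pi_eq; rewrite /= !mulr1.
Qed.

HB.instance Definition _ := GRing.isZmodMorphism.Build R (loc M) loc_map
  loc_map_is_zmod_morphism.

Fact loc_map_is_monoid_morphism : monoid_morphism loc_map.
Proof.
split=> [//|x y]; rewrite /loc_map; unlock Localization.ofring.
rewrite -[RHS]Localization.pi_mul.
by apply: Localization.pi_eq; rewrite /= !mulr1.
Qed.

HB.instance Definition _ := GRing.isMonoidMorphism.Build R (loc M) loc_map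
  loc_map_is_monoid_morphism.

Lemma loc_map_inv s : W s -> exists y, loc_map s * y = 1.
Proof.
move=> Ws; exists (\pi_(loc M) (Localization.mk 1 Ws)).
rewrite -(rmorph1 loc_map) /= /loc_map; unlock Localization.ofring.
rewrite -[LHS]Localization.pi_mul.
by apply: Localization.pi_eq; rewrite /= !mulr1 !mul1r.
Qed.

Lemma loc_surj (x : loc M) :
  exists a, exists2 s, W s & x * loc_map s = loc_map a.
Proof.
elim/quotW: x => -[a s]; exists a, (val s); first by have := valP s; rewrite inE.
rewrite /loc_map; unlock Localization.ofring.
rewrite -[LHS]Localization.pi_mul.
by apply: Localization.pi_eq; rewrite /= !mulr1.
Qed.

Lemma loc_map_eq0 a : loc_map a = 0 <-> exists2 u, W u & u * a = 0.
Proof.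
rewrite -(rmorph0 loc_map) /= /loc_map; unlock Localization.ofring.
split=> [/eqP/Localization.piP[u Wu] | [u Wu ua]].
  by rewrite /= !mulr1 mulr0 => ua; exists u.
by apply/eqP/Localization.piP; exists u; rewrite //= !mulr1 mulr0.
Qed.

(* [Spec (loc M)], viewed inside [Spec R] by contraction, consists of
   the primes disjoint from [M]. *)
Lemma spec_map_loc :
  spec_map loc_map @` Spec (loc M) = [set p | Spec R p /\ p `&` W = set0].
Proof.
have invE s : W s -> exists y, loc_map s * y = 1 by exact: loc_map_inv.
apply/seteqP; split=> [_ [q [[q0 qD qM] qT qP] <-] | p [[[p0 pD pM] pT pP] pW]].
  have q1 : ~ q 1.
    by move=> q1; apply: qT; apply/seteqP; split=> // x _; rewrite -[x]mulr1; apply: qM.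
  split; first split.
  - split; rewrite /spec_map /preimage /=.
    + by rewrite rmorph0.
    + by move=> x y qx qy; rewrite rmorphD; apply: qD.
    + by move=> a x qx; rewrite rmorphM; apply: qM.
  - by move=> qR; apply: q1; rewrite -(rmorph1 loc_map); rewrite -[q _]/((spec_map loc_map q) 1) qR.
  - by move=> x y; rewrite /spec_map /preimage /= rmorphM; apply: qP.
  apply/seteqP; split=> // s [qs /invE[y sy]]; apply: q1.
  by rewrite -sy mulrC; apply: qM.
have npW s : W s -> ~ p s by move=> Ws ps; rewrite -[False]/(set0 s) -pW.
pose q := [set x : loc M | exists2 a, p a & exists2 s, W s & x * loc_map s = loc_map a].
have qE a : q (loc_map a) <-> p a.
  split=> [[b pb [s Ws]] | pa]; last first.
    by exists a => //; exists 1; [exact: mulset1 | rewrite rmorph1 mulr1].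
  move/eqP; rewrite -rmorphM -subr_eq0 -rmorphB => /eqP/loc_map_eq0[u Wu e].
  have : p (u * (a * s)).
    rewrite -[a * s](subrK b) mulrDr e add0r; exact: pM.
  by case/pP=> [/(npW _ Wu)//|/pP[//|/(npW _ Ws)]].
have qS x s : W s -> q (x * loc_map s) -> q x.
  move=> Ws [a pa [t Wt e]]; exists a => //; exists (s * t); first exact: mulsetM.
  by rewrite rmorphM mulrA.
have qM a x : q x -> q (a * x).
  have [b [t Wt e]] := loc_surj a => -[c pc [s Ws ex]].
  exists (b * c); first exact: pM.
  exists (t * s); first exact: mulsetM.
  by rewrite !rmorphM mulrACA e ex.
exists q; last by apply/seteqP; split=> x /qE.
split; first split=> //.
- by rewrite -(rmorph0 loc_map); apply/qE.
- move=> x y [a pa [s Ws ex]] [b pb [t Wt ey]].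
  exists (t * a + s * b); first by apply: pD; apply: pM.
  exists (s * t); first exact: mulsetM.
  by rewrite rmorphD !rmorphM mulrDl mulrA ex mulrC [loc_map s * _]mulrC mulrA ey [_ * loc_map s]mulrC.
- move=> qT; apply: pT; apply/seteqP; split=> // x _.
  by apply/qE; rewrite qT.
- move=> x y; have [a [s Ws ex]] := loc_surj x; have [b [t Wt ey]] := loc_surj y.
  move=> qxy; have /qE/pP : q (loc_map (a * b)).
    rewrite rmorphM /= -ex -ey mulrACA mulrC; exact: qM.
  case=> [pa|pb]; [left; apply: (qS _ _ Ws) | right; apply: (qS _ _ Wt)].
    by rewrite ex; apply/qE.
  by rewrite ey; apply/qE.
Qed.

(* Universal property: with [loc_lift_uniq], a ring map inverting [M] induces
   exactly one ring map out of [loc M]. *)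
Lemma loc_lift (S : comPzRingType) (phi : {rmorphism R -> S}) :
  (forall s, W s -> exists y, phi s * y = 1) ->
  exists psi : {rmorphism loc M -> S}, forall a, psi (loc_map a) = phi a.
Proof.
move=> phiW.
have ex x : exists y, exists a s, [/\ W s, x * loc_map s = loc_map a & y * phi s = phi a].
  have [a [s Ws e]] := loc_surj x; have [y sy] := phiW _ Ws.
  by exists (phi a * y), a, s; split=> //; rewrite -mulrA [y * _]mulrC sy mulr1.
pose f x := projT1 (cid (ex x)).
have fP x a s : W s -> x * loc_map s = loc_map a -> f x * phi s = phi a.
  move=> Ws e; rewrite /f; case: cid => /= y [b [t [Wt e' ey]]].
  have /eqP : loc_map (b * s) = loc_map (a * t).
    by rewrite !rmorphM /= -e -e' mulrAC.
  rewrite -subr_eq0 -rmorphB => /eqP/loc_map_eq0[u Wu].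
  move/(congr1 phi); rewrite rmorphM rmorphB !rmorphM -ey rmorph0 => e0.
  have [v uv] := phiW _ Wu; have [z tz] := phiW _ Wt.
  have /eqP : y * phi t * phi s - phi a * phi t = 0.
    by rewrite -[LHS]mul1r -uv mulrAC e0 mul0r.
  rewrite subr_eq0 => /eqP/(congr1 (fun c => c * z)).
  by rewrite [LHS]mulrAC -[y * _ * z]mulrA -[RHS]mulrA tz !mulr1.
have fI x y s : W s -> x * phi s = y * phi s -> x = y.
  move=> /phiW[z sz] /(congr1 (fun c => c * z)).
  by rewrite -!mulrA sz !mulr1.
have fB : zmod_morphism f.
  move=> x y; have [a [s Ws exx]] := loc_surj x; have [b [t Wt ey]] := loc_surj y.
  apply: (fI _ _ (s * t)); first exact: mulsetM.
  rewrite (fP _ (a * t - b * s)) //; last 2 first.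
  - exact: mulsetM.
  - by rewrite rmorphB !rmorphM /= -exx -ey mulrBl !mulrA [y * _ * _]mulrAC.
  rewrite rmorphB !rmorphM /= -(fP _ _ _ Ws exx) -(fP _ _ _ Wt ey).
  by rewrite mulrBl !mulrA [f y * _ * _]mulrAC.
have fM : monoid_morphism f.
  split.
    by rewrite -[LHS]mulr1 -(rmorph1 phi); apply: fP; [exact: mulset1 | rewrite mul1r].
  move=> x y; have [a [s Ws exx]] := loc_surj x; have [b [t Wt ey]] := loc_surj y.
  apply: (fI _ _ (s * t)); first exact: mulsetM.
  rewrite (fP _ (a * b)) //; last 2 first.
  - exact: mulsetM.
  - by rewrite !rmorphM /= -exx -ey mulrACA.
  by rewrite !rmorphM /= -(fP _ _ _ Ws exx) -(fP _ _ _ Wt ey) mulrACA.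
pose fB' := GRing.isZmodMorphism.Build _ _ f fB.
pose fM' := GRing.isMonoidMorphism.Build _ _ f fM.
pose psi : {rmorphism loc M -> S} := HB.pack f fB' fM'.
exists psi => a; rewrite -[psi _]/(f _) -[LHS]mulr1 -(rmorph1 phi).
by apply: fP; [exact: mulset1 | rewrite rmorph1 mulr1].
Qed.

Lemma loc_lift_uniq (S : comPzRingType) (psi1 psi2 : {rmorphism loc M -> S}) :
  (forall a, psi1 (loc_map a) = psi2 (loc_map a)) -> psi1 =1 psi2.
Proof.
move=> e x; have [a [s Ws ex]] := loc_surj x; have [y sy] := loc_map_inv Ws.
rewrite -[x]mulr1 -sy mulrA ex !rmorphM e; congr (_ * _).
rewrite -[LHS]mulr1 -(rmorph1 psi2) -sy rmorphM -e mulrA -rmorphM [y * _]mulrC sy.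
by rewrite rmorph1 mul1r.
Qed.

End LocalizationTheory.

(* Main.v *)
Require Import Defs.
From HB Require Import structures.
From mathcomp Require Import all_boot all_algebra.
From mathcomp Require Import boolp classical_sets.

Set Implicit Arguments.
Unset Strict Implicit.
Unset Printing Implicit Defensive.

Import GRing.Theory.

Local Open Scope classical_set_scope.
Local Open Scope ring_scope.

(* The contractions of the maximal ideals of the localization are exactly the
   ideals of [R] maximal among those contained in the union of [Lambda], and by
   Zorn's lemma every ideal contained in that union lies in one of them. Hence
   as soon as each of them lies below some member of [Lambda], they are
   precisely the maximal elements of [Lambda], and every ideal contained in the
   union lies in a maximal element of [Lambda]; all eight conditions follow
   from this and imply it. *)

(** [A] stays arbitrary: the union of [Lambda], the complement of a multiplicative set, or that of
    1. *)
Definition maximal_within (R : comPzRingType) (A p : set R) : Prop :=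
  [/\ ideal p, p `<=` A &
      forall J, ideal J -> J `<=` A -> p `<=` J -> J = p].

(** * Ideals maximal within a set, and their primality *)

Section Ideals.
Variable R : comPzRingType.
Implicit Types (A I J m p : set R) (L : set (set R)).

Lemma ideal1_setT I : ideal I -> I 1 -> I = setT.
Proof.
by move=> [_ _ IM] I1; apply/seteqP; split=> // x _; rewrite -[x]mulr1; apply: IM.
Qed.

Lemma ex_maximal_within A I : ideal I -> I `<=` A ->
  exists2 p, maximal_within A p & I `<=` p.
Proof.
move=> idI IA.
(* The sets [X] are compared through [I `|` X] so that the empty chain,
   whose union is not an ideal, needs no special treatment. *)
pose P : set (set R) := [set X | ideal (I `|` X) /\ I `|` X `<=` A].
have [|X [[idX XA] Xmax]] := @Zorn_bigcup R P.
  move=> F FP Ftot; have [I0 ID IM] := idI; split; first split.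
  - by left.
  - move=> x y [Ix|[X FX Xx]] [Iy|[Y FY Yy]].
    + by left; apply: ID.
    + have [[_ D _] _] := FP _ FY.
      by have [|H] := D x y (or_introl Ix) (or_intror Yy); [left|right; exists Y].
    + have [[_ D _] _] := FP _ FX.
      by have [|H] := D x y (or_intror Xx) (or_introl Iy); [left|right; exists X].
    + have [XY|YX] := Ftot _ _ FX FY.
        have [[_ D _] _] := FP _ FY.
        have [|H] := D x y (or_intror (XY _ Xx)) (or_intror Yy); first by left.
        by right; exists Y.
      have [[_ D _] _] := FP _ FX.
      have [|H] := D x y (or_intror Xx) (or_intror (YX _ Yy)); first by left.
      by right; exists X.
  - move=> a x [Ix|[X FX Xx]]; first by left; apply: IM.
    have [[_ _ M] _] := FP _ FX.
    by have [|H] := M a x (or_intror Xx); [left|right; exists X].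
  - move=> x [/IA//|[X FX Xx]].
    by have [_] := FP _ FX; apply; right.
exists (I `|` X); last by move=> x; left.
split=> // J idJ JA XJ; apply/seteqP; split=> // x Jx.
(* [J] absorbs [I], so it lies in [P]; a point of [J] outside [I] and [X] would make it strictly
   larger than [X]. *)
have JE : I `|` J = J by apply/seteqP; split=> y; [case=> // Iy; apply: XJ; left | right].
apply: contrapT => nx; apply: (Xmax J); last by rewrite /P /= JE.
split=> [y Xy|JX]; first by apply: XJ; right.
by apply: nx; right; apply: JX.
Qed.

(** An ideal is proper exactly when it omits 1, so it can be enlarged inside the complement of 1. *)
Lemma ex_maximal_ideal I : ideal I -> I <> setT ->
  exists2 m, maximal_ideal m & I `<=` m.
Proof.
move=> idI IT; have [|m [idm m1 mmax] Im] := @ex_maximal_within (~` [set 1]) I idI.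
  by move=> x Ix x1; apply: IT; apply: ideal1_setT => //; rewrite -x1.
exists m => //; split=> // [mT|J idJ mJ].
  by apply: (m1 1) => //; rewrite mT.
have [J1|nJ1] := pselect (J 1); first by right; apply: ideal1_setT.
by left; apply: mmax => // x Jx x1; apply: nJ1; rewrite -x1.
Qed.

(** This is I + Rx, the enlargement against which maximality is tested. *)
Lemma ideal_add_principal I x : ideal I ->
  ideal [set z | exists2 a, I a & exists r, z = a + r * x].
Proof.
move=> [I0 ID IM]; split.
- by exists 0 => //; exists 0; rewrite mul0r addr0.
- move=> _ _ [a Ia [r ->]] [b Ib [s ->]]; exists (a + b); first exact: ID.
  by exists (r + s); rewrite mulrDl addrACA.
- move=> c _ [a Ia [r ->]]; exists (c * a); first exact: IM.
  by exists (c * r); rewrite mulrDr mulrA.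
Qed.

(** If x and y lie outside [p], then p + Rx and p + Ry both meet [M]; the product of the elements
    found is in [M], and in [p] if xy is. *)
Lemma maximal_within_prime (M : mulset R) p :
  maximal_within (~` M) p -> prime_ideal p.
Proof.
move=> [idp pM pmax]; have [p0 pD pR] := idp.
split=> // [pT|x y pxy].
  by apply: (pM 1); [rewrite pT | exact: mulset1].
have meet z : ~ p z -> exists a r, p a /\ mulset_set M (a + r * z).
  move=> npz; apply: contrapT => nmeet; apply: npz.
  rewrite -(pmax _ (ideal_add_principal z idp)).
  - by exists 0 => //; exists 1; rewrite add0r mul1r.
  - by move=> _ [a pa [r ->]] Mar; apply: nmeet; exists a, r.
  - by move=> a pa; exists a => //; exists 0; rewrite mul0r addr0.
apply: contrapT => /not_orP[/meet[a [r [pa Ma]]] /meet[b [s [pb Mb]]]].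
apply: (pM _ _ (mulsetM Ma Mb)).
rewrite mulrDl; apply: (pD); first by rewrite mulrC; apply: pR.
rewrite mulrDr; apply: pD; first exact: pR.
by rewrite mulrACA; apply: pR.
Qed.

(** A maximal ideal is maximal within the complement of the multiplicative set {1}. *)
Lemma maximal_ideal_prime m : maximal_ideal m -> prime_ideal m.
Proof.
move=> [idm mT mmax].
have M1 (x y : R) : x = 1 -> y = 1 -> x * y = 1 by move=> -> ->; rewrite mulr1.
apply: (@maximal_within_prime (@Mulset R [set 1] erefl M1)); split=> //.
  by move=> x mx x1; apply: mT; apply: ideal1_setT => //; rewrite -x1.
move=> J idJ J1 mJ; have [//|JT] := mmax _ idJ mJ.
by case: (J1 1) => //; rewrite JT.
Qed.

End Ideals.

Lemma ideal_spec_map (R S : comPzRingType) (phi : {rmorphism R -> S}) (q : set S) :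
  ideal q -> ideal (spec_map phi q).
Proof.
move=> [q0 qD qM]; rewrite /spec_map /preimage; split=> /=.
- by rewrite rmorph0.
- by move=> x y qx qy; rewrite rmorphD; apply: qD.
- by move=> a x qx; rewrite rmorphM; apply: qM.
Qed.

Lemma spec_map_proper (R S : comPzRingType) (phi : {rmorphism R -> S}) (q : set S) :
  ideal q -> q <> setT -> spec_map phi q <> setT.
Proof.
move=> idq qT pT; apply: qT; apply: ideal1_setT => //.
by rewrite -(rmorph1 phi) -[q _]/(spec_map phi q 1) pT.
Qed.

(** * Maximal ideals of a localization *)

Section LocMax.
Variables (R : comPzRingType) (M : mulset R).
Implicit Types (p : set R) (q : set (loc M)).

(** An ideal of the localization is generated by its contraction: each fraction is its numerator
    times a unit. *)
Lemma spec_map_loc_subset q q' : ideal q -> ideal q' ->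
  spec_map (@loc_map R M) q `<=` spec_map (@loc_map R M) q' -> q `<=` q'.
Proof.
move=> [_ _ qM] [_ _ q'M] qq' x qx.
have [a [s Ms e]] := loc_surj x; have [y sy] := loc_map_inv Ms.
rewrite -[x]mulr1 -sy mulrA e mulrC; apply/q'M/qq'.
by rewrite /spec_map /preimage /= -e mulrC; apply: qM.
Qed.

Lemma spec_map_loc_disjoint q : ideal q -> q <> setT ->
  spec_map (@loc_map R M) q `<=` ~` M.
Proof.
move=> idq qT s qs Ms; have [y sy] := loc_map_inv Ms.
apply: qT; apply: ideal1_setT => //; rewrite -sy mulrC.
by case: idq => _ _; apply.
Qed.

Lemma spec_map_loc_mSpec :
  spec_map (@loc_map R M) @` mSpec (loc M) = [set p | maximal_within (~` M) p].
Proof.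
(* Such a [p] is prime, hence contracted from some [q]; a proper ideal above [q] also contracts to
   [p], so it equals [q]. *)
have sub p : maximal_within (~` M) p ->
    (spec_map (@loc_map R M) @` mSpec (loc M)) p.
  move=> pmax; have [_ pM maxp] := pmax.
  have : (spec_map (@loc_map R M) @` Spec (loc M)) p.
    rewrite spec_map_loc; split; first exact: maximal_within_prime pmax.
    by apply/seteqP; split=> // x [/pM].
  move=> [q [idq qT _] qp]; exists q => //; split=> // J idJ qJ.
  have [->|JT] := pselect (J = setT); [by right | left].
  apply/seteqP; split=> //; apply: spec_map_loc_subset => //.
  rewrite qp (maxp (spec_map (@loc_map R M) J)) //.
  - exact: ideal_spec_map.
  - exact: spec_map_loc_disjoint.
  - by rewrite -qp => x; apply: qJ.
apply/seteqP; split=> // _ [n [idn nT nmax] <-].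
split=> [||J idJ JM nJ]; first exact: ideal_spec_map.
  exact: spec_map_loc_disjoint.
(* [J] is enlarged to the contraction of a proper [q] above [n]; maximality of [n] gives [q = n],
   which squeezes [J]. *)
have [p /[dup] pmax /sub[q [idq qT _] qp] Jp] := ex_maximal_within idJ JM.
apply/seteqP; split=> //.
have [<-|//] : q = n \/ q = setT.
  apply: nmax => //; apply: spec_map_loc_subset => //.
  by rewrite qp; apply: subset_trans Jp.
by rewrite qp.
Qed.

End LocMax.

(** * Prime avoidance and maximal elements *)

Section Avoidance.
Variables (R : comPzRingType) (L : set (set R)).
Hypothesis LSpec : L `<=` Spec R.

Let U : set R := \bigcup_(p in L) p.

Lemma bigcup_down_closure : \bigcup_(p in down_closure L) p = U.
Proof.
apply/seteqP; split=> x [p].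
  by case=> _ [q Lq pq] px; exists q => //; apply: pq.
by move=> Lp px; exists p => //; split; [exact: LSpec | exists p].
Qed.

(** Avoidance need only be tested on ideals maximal within the union; these are prime, as
    [down_closure] demands, because the complement of the union is multiplicative. *)
Lemma prime_avoidanceP :
  prime_avoidance L <-> [set p | maximal_within U p] `<=` down_closure L.
Proof.
split=> [PA p pmax | H I idI IU].
  have [idp pU _] := pmax; have [q Lq pq] := PA _ idp pU.
  split; last by exists q.
  apply: (@maximal_within_prime _ (primes_compl LSpec)).
  by rewrite /= setCK.
have [p /H[_ [q Lq pq]] Ip] := ex_maximal_within idI IU.
by exists q => //; apply: subset_trans pq.
Qed.

(** Members of [L] are ideals inside the union, so an ideal maximal there and below a member equals
    it. Conversely a maximal element [p] lies in some [p'] below some [q] in [L], and all three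
    coincide. *)
Lemma maximal_within_max_elts :
  prime_avoidance L -> [set p | maximal_within U p] = max_elts L.
Proof.
move/prime_avoidanceP => H; apply/seteqP; split=> [p pmax | p [Lp maxp]].
  have [idp pU maxp] := pmax; have [_ [q Lq pq]] := H _ pmax.
  have ideal_L q' : L q' -> ideal q' by move=> /LSpec[].
  have qp : q = p by apply: maxp => //; [exact: ideal_L | exact: bigcup_sup].
  split=> [|q' Lq' q'p pq']; first by rewrite -qp.
  by apply: q'p; apply: maxp => //; [exact: ideal_L | exact: bigcup_sup].
have [idp _ _] := LSpec Lp.
have [p' p'max pp'] := ex_maximal_within idp (bigcup_sup Lp).
have [_ [q Lq p'q]] := H _ p'max.
have pq : p `<=` q by apply: subset_trans p'q.
have [qp|qp] := pselect (q = p); last by case: (maxp _ Lq qp).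
suff -> : p = p' by [].
by apply/seteqP; split=> //; rewrite -qp.
Qed.

Lemma prime_avoidance_down_closure :
  prime_avoidance (down_closure L) <-> prime_avoidance L.
Proof.
rewrite /prime_avoidance bigcup_down_closure -/U.
split=> PA I idI /(PA _ idI)[p].
  by case=> _ [q Lq pq] Ip; exists q => //; apply: subset_trans pq.
by move=> Lp Ip; exists p => //; split; [exact: LSpec | exists p].
Qed.

Lemma prime_avoidance_max_elts : prime_avoidance L ->
  prime_avoidance (max_elts L) /\ L `<=` down_closure (max_elts L).
Proof.
move=> PA.
have sub I : ideal I -> I `<=` U -> exists2 p, max_elts L p & I `<=` p.
  move=> idI IU; have [p pmax Ip] := ex_maximal_within idI IU.
  by exists p => //; rewrite -maximal_within_max_elts.
split=> [I idI IU|p Lp].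
  by apply: sub => // x /IU[p [Lp _] px]; exists p.
split; first exact: LSpec.
by apply: sub; [case: (LSpec Lp) | exact: bigcup_sup].
Qed.

(** The second hypothesis gives both families the same union. *)
Lemma max_elts_prime_avoidance :
  prime_avoidance (max_elts L) -> L `<=` down_closure (max_elts L) ->
  prime_avoidance L.
Proof.
move=> PA Lcl I idI IU; have [|p [Lp _] Ip] := PA _ idI; last by exists p.
by move=> x /IU[p /Lcl[_ [q mq pq]] px]; exists q => //; apply: pq.
Qed.

End Avoidance.

(** A maximal ideal above [q] contracts to a proper ideal containing the maximal ideal [n], hence to
    [n]. *)
Lemma surjective_on_closed_points_mSpec (A S : comPzRingType)
    (psi : {rmorphism A -> S}) :
  surjective_on_closed_points psi -> mSpec A `<=` spec_map psi @` mSpec S.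
Proof.
move=> surj n nmax; have [q [idq qT _] qn] := surj _ nmax.
have [m /[dup] mmax [idm mT _] qm] := ex_maximal_ideal idq qT.
exists m => //; case: nmax => _ _ /(_ (spec_map psi m)) [].
- exact: ideal_spec_map.
- by rewrite -qn => x; apply: qm.
- by [].
- by move/(spec_map_proper idm mT).
Qed.

Theorem theorem4 (R : comNzRingType) (Lambda : set (set R))
    (LambdaSpec : Lambda `<=` Spec R) :
  let W := primes_compl LambdaSpec in
  [<-> (* 1 *) prime_avoidance Lambda;
       (* 2 *) spec_map (@loc_map R W) @` mSpec (loc W) `<=` max_elts Lambda;
       (* 3 *) spec_map (@loc_map R W) @` mSpec (loc W) = max_elts Lambda;
       (* 4 *) spec_map (@loc_map R W) @` mSpec (loc W) `<=` down_closure Lambda;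
       (* 5 *) spec_map (@loc_map R W) @` Spec (loc W) = down_closure Lambda;
       (* 6 *) exists (S : comPzRingType) (phi : {rmorphism R -> S}),
                 max_elts Lambda = spec_map phi @` mSpec S /\
                 exists psi : {rmorphism loc W -> S},
                   (forall a, psi (loc_map W a) = phi a) /\
                   surjective_on_closed_points psi;
       (* 7 *) prime_avoidance (down_closure Lambda);
       (* 8 *) prime_avoidance (max_elts Lambda) /\
               Lambda `<=` down_closure (max_elts Lambda)].
Proof.
move=> W.
have U_W : ~` (W : set R) = \bigcup_(p in Lambda) p by exact: setCK.
have max_down : max_elts Lambda `<=` down_closure Lambda.
  by move=> p [Lp _]; split; [exact: (LambdaSpec) | exists p].
have mSpec_Spec : spec_map (@loc_map R W) @` mSpec (loc W) `<=`
    spec_map (@loc_map R W) @` Spec (loc W).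
  by move=> _ [n nmax <-]; exists n => //; apply: maximal_ideal_prime.
have avoidE : prime_avoidance Lambda <->
    spec_map (@loc_map R W) @` mSpec (loc W) `<=` down_closure Lambda.
  by rewrite spec_map_loc_mSpec U_W; exact: prime_avoidanceP.
have maxE : prime_avoidance Lambda ->
    spec_map (@loc_map R W) @` mSpec (loc W) = max_elts Lambda.
  by rewrite spec_map_loc_mSpec U_W; exact: maximal_within_max_elts.
tfae.
- by move/maxE->.
- by move=> H; apply/maxE/avoidE; apply: subset_trans max_down.
- by move->.
(* A prime disjoint from [W] lies in the union of [Lambda], so avoidance puts it below a member. *)
- move=> /avoidE PA; rewrite spec_map_loc; apply/seteqP.
  split=> p [pP].
    move=> pW; split=> //; apply: PA; first by case: pP.
    by rewrite -U_W => x px Wx; rewrite -[False]/(set0 x) -pW.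
  move=> [q Lq pq]; split=> //; apply/seteqP; split=> // x [px].
  by apply; exists q => //; apply: pq.
(* The localization itself serves as [S], with the identity as [psi]. *)
- move=> H; exists (loc W), (@loc_map R W); split.
    by rewrite maxE //; apply/avoidE; rewrite -H.
  exists idfun; split=> // n nmax; exists n => //.
  exact: maximal_ideal_prime.
- move=> [S [phi [maxS [psi [psiE /surjective_on_closed_points_mSpec surj]]]]].
  apply/(prime_avoidance_down_closure LambdaSpec)/avoidE.
  (* Each maximal ideal of the localization is contracted from a maximal [m] of [S], and contracting
     on to [R] is contracting [m] along [phi]. *)
  apply: subset_trans max_down; rewrite maxS => _ [_ /surj[m mmax <-] <-].
  by exists m => //; apply/seteqP; split=> x; rewrite /spec_map /preimage /= psiE.
- by move/(prime_avoidance_down_closure LambdaSpec)/(prime_avoidance_max_elts LambdaSpec).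
- by move=> [PA Lcl]; apply: max_elts_prime_avoidance.
Qed.
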